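(* Let $p^0,n^0,\rho^f\in\mathcal{C}$ be real grid functions with $\langle p^0-n^0+\rho^f,1\rangle_h=0$, let $\epsilon>0$ and $\tau>0$. Let $(p^k,n^k,\phi^k)_{k\ge 0}$ be the solution of the ETD1 scheme with time step $\tau$. If $p^0\ge 0$ and $n^0\ge 0$ (entrywise), then for every $k\ge0$, $$E^{k+1}\le E^k+\frac{\epsilon^2}{2}\|\nabla_h(\phi^{k+1}-\phi^k)\|_h^2,$$ where $$E^k=\langle p^k\ln p^k,1\rangle_h+\langle n^k\ln n^k,1\rangle_h+\frac{\epsilon^2}{2}\|\nabla_h\phi^k\|_h^2.$$
   Context: Let $L>0$, $N\in\mathbb{Z}^+$, $h=L/N$. $\mathcal{C}$ denotes the space of real grid functions $u=(u_{i,j})_{i,j\in\mathbb{Z}}$ that are $N$-periodic in each index (an $N^2$-dimensional space). The discrete inner product is $\langle u,v\rangle_h=h^2\sum_{i,j=1}^N u_{i,j}v_{i,j}$, and $1$ denotes the constant grid function. Products and logarithms of grid functions are entrywise, with the convention $0\ln 0=0$. Further, $$\langle\nabla_h u,\nabla_h v\rangle_h=h^2\sum_{i,j=1}^N\left(\frac{u_{i,j}-u_{i-1,j}}{h}\cdot\frac{v_{i,j}-v_{i-1,j}}{h}+\frac{u_{i,j}-u_{i,j-1}}{h}\cdot\frac{v_{i,j}-v_{i,j-1}}{h}\right),\qquad \|\nabla_h u\|_h=\langle\nabla_h u,\nabla_h u\rangle_h^{1/2}.$$ The discrete Laplacian is $(\Delta_h u)_{i,j}=\frac1{h^2}(u_{i+1,j}+u_{i-1,j}+u_{i,j+1}+u_{i,j-1}-4u_{i,j})$.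 For $f\in\mathcal{C}$ with $\langle f,1\rangle_h=0$, $(-\epsilon^2\Delta_h)^{-1}f$ denotes the unique $\phi\in\mathcal{C}$ with $-\epsilon^2\Delta_h\phi=f$ and $\langle\phi,1\rangle_h=0$. For $\phi\in\mathcal{C}$, the linear operator $\mathcal{L}_h[\phi]:\mathcal{C}\to\mathcal{C}$ is $$(\mathcal{L}_h[\phi]u)_{i,j}=\frac1{h^2}\sum_{(i',j')}\frac{2e^{\phi_{i',j'}}e^{\phi_{i,j}}}{e^{\phi_{i',j'}}+e^{\phi_{i,j}}}\left(\frac{u_{i',j'}}{e^{\phi_{i',j'}}}-\frac{u_{i,j}}{e^{\phi_{i,j}}}\right),$$ the sum being over the four neighbours $(i',j')\in\{(i+1,j),(i-1,j),(i,j+1),(i,j-1)\}$. It discretizes $\nabla\cdot(e^{\phi}\nabla(u/e^{\phi}))$. ETD1 scheme (first-order exponential time differencing scheme for the Poisson–Nernst–Planck equations): given $p^0,n^0$, set $\phi^0=(-\epsilon^2\Delta_h)^{-1}(p^0-n^0+\rho^f)$, and for $k\ge0$ $$p^{k+1}=e^{\tau\mathcal{L}_h[-\phi^k]}p^k,\qquad n^{k+1}=e^{\tau\mathcal{L}_h[\phi^k]}n^k,\qquad \phi^{k+1}=(-\epsilon^2\Delta_h)^{-1}(p^{k+1}-n^{k+1}+\rho^f),$$ where $e^{(\cdot)}$ of an operator is the operator exponential. The scheme is well defined because $p^k-n^k+\rho^f$ has zero mean for every $k$, and $p^k,n^k\ge0$ for all $k$ when $p^0,n^0\ge 0$. *)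

(* Defs.v *)
From mathcomp Require Import all_boot all_order all_algebra.
From mathcomp Require Import all_classical all_reals all_analysis.
Set Implicit Arguments.
Unset Strict Implicit.
Unset Printing Implicit Defensive.
Import Order.TTheory GRing.Theory Num.Theory.
Import numFieldNormedType.Exports.
Local Open Scope classical_set_scope.
Local Open Scope ring_scope.

(* An N-periodic grid function on Z x Z is encoded by its values on Z/N x Z/N,
   as u : 'M[R]_N (N > 0); the shifts i+1 and i-1 are the cyclic [ordS i] and
   [ord_pred i].  Matrix multiplication is never used. *)
Section Grid.
Context {R : realType} {N : nat}.
Implicit Types (h eps tau : R) (u v f phi p n : 'M[R]_N).

(* The constant grid function 1, not the identity matrix. *)
Definition grid1 : 'M[R]_N := const_mx 1.

Definition inner h u v : R := h ^+ 2 * \sum_i \sum_j u i j * v i j.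

Definition grad_inner h u v : R :=
  h ^+ 2 * \sum_i \sum_j
    ((u i j - u (ord_pred i) j) / h * ((v i j - v (ord_pred i) j) / h)
     + (u i j - u i (ord_pred j)) / h * ((v i j - v i (ord_pred j)) / h)).

Definition grad_norm h u : R := Num.sqrt (grad_inner h u u).

(* A list rather than a set: for N <= 2 neighbours coincide modulo N and must be
   counted with multiplicity. *)
Definition neighbours (i j : 'I_N) : seq ('I_N * 'I_N) :=
  [:: (ordS i, j); (ord_pred i, j); (i, ordS j); (i, ord_pred j)].

Definition laplacian h u : 'M[R]_N :=
  \matrix_(i, j) ((h ^+ 2)^-1 *
    (u (ordS i) j + u (ord_pred i) j + u i (ordS j) + u i (ord_pred j)
     - 4 * u i j)).

(* The zero-mean phi with - eps^2 Delta_h phi = f; the default value 0 is only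
   taken when there is none, i.e. when f does not have zero mean. *)
Definition poisson_inv h eps f : 'M[R]_N :=
  xget 0 [set phi | (- eps ^+ 2) *: laplacian h phi = f
                    /\ inner h phi grid1 = 0].

Definition Lop h phi u : 'M[R]_N :=
  \matrix_(i, j) ((h ^+ 2)^-1 *
    \sum_(q <- neighbours i j)
      2 * expR (phi q.1 q.2) * expR (phi i j)
        / (expR (phi q.1 q.2) + expR (phi i j))
      * (u q.1 q.2 / expR (phi q.1 q.2) - u i j / expR (phi i j))).

(* e^T u = sum_m T^m u / m!.  The space is finite-dimensional, so for linear T
   this is the evaluation at u of the norm-convergent series of operators. *)
Definition op_exp (T : 'M[R]_N -> 'M[R]_N) u : 'M[R]_N :=
  lim (series (fun m : nat => (m`!%:R)^-1 *: iter m T u) @ \oo).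

Definition etd1_solution h eps tau (rhof p0 n0 : 'M[R]_N)
    (p n phi : nat -> 'M[R]_N) : Prop :=
  [/\ p 0%N = p0, n 0%N = n0,
      forall k, phi k = poisson_inv h eps (p k - n k + rhof),
      forall k, p k.+1 = op_exp (fun u => tau *: Lop h (- phi k) u) (p k)
    & forall k, n k.+1 = op_exp (fun u => tau *: Lop h (phi k) u) (n k)].

(* [ln 0 = 0] in the library, so 0 * ln 0 = 0. *)
Definition xlnx u : 'M[R]_N := \matrix_(i, j) (u i j * ln (u i j)).

Definition energy h eps p n phi : R :=
  inner h (xlnx p) grid1 + inner h (xlnx n) grid1
  + eps ^+ 2 / 2 * grad_norm h phi ^+ 2.

End Grid.

(* Main.v *)
Require Import Defs.
From HB Require Import structures.
From mathcomp Require Import all_boot all_order all_algebra.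
From mathcomp Require Import all_classical all_reals all_analysis.
From mathcomp Require Import ring lra.
Import Order.TTheory GRing.Theory Num.Theory.
Import numFieldNormedType.Exports.
Local Open Scope classical_set_scope.
Local Open Scope ring_scope.

(** With [phi = phi^k] fixed, [e^(tau L_h[phi])] is a linear map which is
    positive ([L_h[phi] + c] has nonnegative entries for large [c]), preserves
    the sum over the grid and fixes [e^phi].  Jensen's inequality for such a map
    shows that the relative entropy [<u ln u - u phi, 1>_h] does not increase
    along it.  Applying this to [p] (with [- phi^k]) and [n] (with [phi^k]) and
    adding up, the entropy part of [E^k+1 - E^k] is at most
    [- <(p^k+1 - n^k+1) - (p^k - n^k), phi^k>_h], which by summation by parts is
    [- eps^2 <grad (phi^k+1 - phi^k), grad phi^k>_h].  This cancels the cross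
    term in the expansion of [|grad phi^k+1|^2] around [phi^k]. *)

(** * Exponential series of bounded operators, and their shift by a scalar *)

Lemma series_convolution (R : pzRingType) (V : lmodType R) (y : nat -> R)
    (x : nat -> V) n :
  series (fun m => \sum_(k < m.+1) y (m - k)%N *: x k) n =
  \sum_(k < n) series y (n - k)%N *: x k.
Proof.
elim: n => [|n IHn]; first by rewrite /series /= big_ord0 big_geq.
rewrite {1}/series /= big_nat_recr //= -[X in X + _]/(series _ n) IHn.
rewrite [in RHS]big_ord_recr /= subSnn [in LHS]big_ord_recr /= subnn addrA.
congr (_ + _); last by rewrite seriesEnat /= big_nat1.
rewrite -big_split /=; apply: eq_bigr => k _.
by rewrite subSn 1?ltnW// seriesSr scalerDl.
Qed.

Section Exponential.
Context {R : realType} {V : completeNormedModType R}.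
Implicit Types (x : nat -> V) (T : {linear V -> V}) (u v : V).

(** The operator is a bare function, so that [T + c] can be passed as a lambda term. *)
Definition exp_term (T : V -> V) u : nat -> V :=
  fun m => (m`!%:R)^-1 *: iter m T u.

(** The binomial theorem divided by [m!]. *)
Lemma exp_coeffD (a b : R) m :
  \sum_(k < m.+1) exp_coeff b (m - k)%N * exp_coeff a k = exp_coeff (a + b) m.
Proof.
rewrite /exp_coeff /= addrC exprDn mulr_suml; apply: eq_bigr => k _.
have km : (k <= m)%N by rewrite -ltnS.
have f0 j : (j`!%:R : R) != 0 by rewrite pnatr_eq0 -lt0n fact_gt0.
rewrite -[in RHS]mulr_natr -(bin_fact km) !natrM; field.
by rewrite !f0 pnatr_eq0 -lt0n bin_gt0 km.
Qed.

Lemma normr_exp_coeff (c : R) m : `|exp_coeff c m| = exp_coeff `|c| m.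
Proof.
by rewrite /exp_coeff /= normrM normrX normfV [X in _ / X]ger0_norm ?ler0n.
Qed.

Lemma cvg_series_exp_coeff (c : R) : series (exp_coeff c) @ \oo --> expR c.
Proof. by have := is_cvg_series_exp_coeff c; rewrite /expR. Qed.

(* The difference between the product of the partial sums and the partial sum
   of the Cauchy product is dominated by the same difference for the
   majorants, where it vanishes in the limit since e^a e^b = e^(a + b). *)
Lemma cvg_exp_coeff_convolution (c a C : R) x (l : V) :
  0 <= a -> (forall k, `|x k| <= C * exp_coeff a k) ->
  series x @ \oo --> l ->
  series (fun m => \sum_(k < m.+1) exp_coeff c (m - k)%N *: x k) @ \oo
    --> expR c *: l.
Proof.
move=> a0 xC xl.
set w := series _.
pose b := `|c|.
pose z (n : nat) : R :=
  C * (series (exp_coeff b) n * series (exp_coeff a) n -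
       series (exp_coeff (a + b)) n).
have z0 : z @ \oo --> 0.
  have -> : 0 = C * (expR b * expR a - expR (a + b)).
    by rewrite expRD [expR a * _]mulrC subrr mulr0.
  apply: cvgMr.
  have := cvgB (cvgM (cvg_series_exp_coeff b) (cvg_series_exp_coeff a))
    (cvg_series_exp_coeff (a + b)).
  exact.
have sz n : `|series (exp_coeff c) n *: series x n - w n| <= z n.
  rewrite /z; have -> : series (exp_coeff (a + b)) n =
      \sum_(k < n) series (exp_coeff b) (n - k)%N * exp_coeff a k.
    rewrite -(@series_convolution R R^o).
    by apply: eq_bigr => m _; rewrite -exp_coeffD.
  (* In both differences the weight of the [k]-th term is the block of the exponential series
     between [n - k] and [n]; the block for [c] is bounded by that for [b]. *)
  rewrite /w series_convolution !(seriesEord x) (seriesEord (exp_coeff a)) /=.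
  rewrite scaler_sumr mulr_sumr -!sumrB mulr_sumr.
  rewrite (le_trans (ler_norm_sum _ _ _))// ler_sum// => k _.
  rewrite -scalerBl -mulrBl normrZ.
  rewrite mulrCA ler_pM//.
  have nk : (n - k <= n)%N by exact: leq_subr.
  rewrite !sub_series_geq// (le_trans (ler_norm_sum _ _ _))// ler_sum// => j _.
  by rewrite normr_exp_coeff.
suff : (fun n => series (exp_coeff c) n *: series x n -
    (series (exp_coeff c) n *: series x n - w n)) @ \oo --> expR c *: l - 0.
  rewrite subr0; apply: cvg_trans; apply: near_eq_cvg.
  by near=> n; rewrite opprB addrC subrK.
apply: cvgB; first by apply: cvgZ => //; exact: cvg_series_exp_coeff.
apply: norm_cvg0; apply: (@squeeze_cvgr _ _ _ _ (cst 0) z) => //;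
  last exact: cvg_cst.
  by near=> n; rewrite normr_ge0 sz.
Unshelve. all: by end_near.
Qed.

Lemma exp_termS (f : V -> V) u m : scalable f ->
  m.+1%:R *: exp_term f u m.+1 = f (exp_term f u m).
Proof.
move=> fZ; rewrite /exp_term iterS fZ scalerA factS natrM invfM mulrA.
by rewrite divff ?mul1r// pnatr_eq0.
Qed.

Lemma exp_coeffS (c : R) m : m.+1%:R * exp_coeff c m.+1 = c * exp_coeff c m.
Proof.
rewrite /exp_coeff /= exprS factS natrM; field.
by rewrite nat1r !pnatr_eq0 -lt0n fact_gt0.
Qed.

(** [T] commutes with scalars, so a binomial formula holds. The induction multiplies by [m + 1],
    which turns both recurrences into factorial-free ones. *)
Lemma exp_term_shift T (c : R) u m : exp_term (fun v => T v + c *: v) u m =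
  \sum_(k < m.+1) exp_coeff c (m - k)%N *: exp_term T u k.
Proof.
elim: m => [|m IHm].
  by rewrite big_ord_recl big_ord0 addr0 /exp_coeff /= expr0 fact0 divr1
    scale1r.
have m0 : (m.+1%:R : R) != 0 by rewrite pnatr_eq0.
apply: (scalerI m0); rewrite exp_termS; last first.
  by move=> a v; rewrite linearZ /= scalerDr !scalerA mulrC.
rewrite IHm linear_sum !scaler_sumr /=.
have TZ : scalable T by move=> a v; rewrite linearZ.
under eq_bigr do rewrite linearZ /= -(exp_termS _ _ _ TZ).
pose y k := exp_coeff c (m.+1 - k)%N.
(* Split [m + 1 = k + (m + 1 - k)]: the first part comes from applying [T], the second from [c]. The
   terms [k = 0] and [k = m + 1] vanish respectively. *)
transitivity (\sum_(k < m.+2) (k%:R * y k) *: exp_term T u k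
  + \sum_(k < m.+2) ((m.+1 - k)%:R * y k) *: exp_term T u k).
  rewrite [in RHS]big_ord_recl mul0r scale0r add0r.
  rewrite [X in _ = _ + X]big_ord_recr /= subnn mul0r scale0r addr0.
  congr (_ + _); apply: eq_bigr => k _.
    by rewrite /y /bump /= add1n subSS scalerA mulrC.
  by rewrite /y scalerA -exp_coeffS subSn // -ltnS.
rewrite -big_split; apply: eq_bigr => k _ /=.
by rewrite -scalerDl -mulrDl -natrD subnKC ?scalerA// -ltnS.
Qed.

Section ShiftedExponential.
Variables (T : {linear V -> V}) (M : R).
Hypotheses (M0 : 0 <= M) (TM : forall u, `|T u| <= M * `|u|).

Lemma normr_exp_term_le u k : `|exp_term T u k| <= `|u| * exp_coeff M k.
Proof.
rewrite /exp_term /exp_coeff /= normrZ normfV [X in X^-1]ger0_norm ?ler0n//.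
rewrite mulrA [leLHS]mulrC ler_wpM2r ?invr_ge0 ?ler0n//.
elim: k => [|k IHk]; first by rewrite expr0 mulr1.
by rewrite iterS (le_trans (TM _))// exprS mulrCA ler_wpM2l.
Qed.

Lemma is_cvg_exp_term u : cvgn (series (exp_term T u)).
Proof.
apply: normed_cvg.
apply: (@series_le_cvg _ _ (`|u| *: exp_coeff M)) => [n||n|] /=.
- exact: normr_ge0.
- by move=> n; rewrite mulr_ge0 ?exp_coeff_ge0.
- exact: normr_exp_term_le.
- by apply: is_cvg_seriesZ; exact: is_cvg_series_exp_coeff.
Qed.

(** This serves positivity: for a suitable [c] the shifted series has nonnegative terms, and the
    factor [expR c] is positive. *)
Lemma cvg_exp_term_shift (c : R) u :
  series (exp_term (fun v => T v + c *: v) u) @ \oo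
    --> expR c *: limn (series (exp_term T u)).
Proof.
have -> : exp_term (fun v => T v + c *: v) u = fun m =>
    \sum_(k < m.+1) exp_coeff c (m - k)%N *: exp_term T u k.
  by apply/funext => m; rewrite exp_term_shift.
apply: (@cvg_exp_coeff_convolution c M `|u|) => //; last exact: is_cvg_exp_term.
exact: normr_exp_term_le.
Qed.

End ShiftedExponential.

End Exponential.

(* The library has both structures on matrices, but not their join
   [completeNormedModType]. *)
HB.instance Definition _ (R : realType) m n :=
  Complete.copy 'M[R]_(m, n) 'M[R]_(m, n).

(** * The operator exponential on matrices: linearity, conservation, positivity *)

Section MatrixExponential.
Context {R : realType} {N : nat}.
Implicit Types (T : {linear 'M[R]_N -> 'M[R]_N}) (u v : 'M[R]_N).

(** Expand [u] in the basis [delta_mx i j]; the norm is the largest absolute entry, so it bounds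
    every coefficient. *)
Lemma matrix_linear_bounded T :
  exists2 M, 0 <= M & forall u, `|T u| <= M * `|u|.
Proof.
exists (\sum_i \sum_j `|T (delta_mx i j)|).
  by apply: sumr_ge0 => i _; apply: sumr_ge0.
move=> u; rewrite {1}[u]matrix_sum_delta linear_sum /= mulr_suml.
rewrite (le_trans (ler_norm_sum _ _ _))// ler_sum// => i _.
rewrite linear_sum /= mulr_suml (le_trans (ler_norm_sum _ _ _))//.
rewrite ler_sum// => j _.
rewrite linearZ normrZ mulrC ler_wpM2l//.
rewrite [leRHS]/Num.Def.normr /= mx_normrE.
by apply/bigmax_geP; right => /=; exists (i, j).
Qed.

Lemma cvg_op_exp T u : series (exp_term T u) @ \oo --> op_exp T u.
Proof.
by have [M M0 TM] := matrix_linear_bounded T; exact: is_cvg_exp_term M0 TM u.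
Qed.

Lemma iter_linear T k : linear (iter k T).
Proof. by elim: k => // k IHk a u v; rewrite !iterS IHk linearP. Qed.

Lemma op_exp_linear T : linear (op_exp T).
Proof.
move=> a u v; apply: (@cvg_lim _ (@norm_hausdorff _ _)).
have -> : series (exp_term T (a *: u + v)) =
    a *: series (exp_term T u) + series (exp_term T v).
  rewrite -seriesZ -seriesD; congr series; apply/funext => k.
  change (exp_term T (a *: u + v) k = a *: exp_term T u k + exp_term T v k).
  by rewrite /exp_term iter_linear scalerDr !scalerA mulrC.
by apply: cvgD; [apply: cvgZr|]; exact: cvg_op_exp.
Qed.

Lemma op_exp_fixed T u : T u = 0 -> op_exp T u = u.
Proof.
move=> Tu; apply: (@cvg_lim _ (@norm_hausdorff _ _)).
(* The empty partial sum is 0; the sequence is constant from index 1 on. *)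
rewrite -cvg_shiftS.
rewrite (_ : [sequence _]_n = cst u); first exact: cvg_cst.
apply/funext => m; rewrite /series /= big_nat_recl// fact0 invr1 scale1r.
rewrite big1 ?addr0// => k _; rewrite iterSr Tu.
suff -> : iter k T 0 = 0 by rewrite scaler0.
by elim: k => //= k ->; rewrite linear0.
Qed.

(** The sum of entries is a continuous linear functional that vanishes on the range of [T], so only
    the zeroth term of the series contributes. *)
Lemma op_exp_sum T u :
  (forall v, \sum_i \sum_j T v i j = 0) ->
  \sum_i \sum_j op_exp T u i j = \sum_i \sum_j u i j.
Proof.
move=> T0.
pose s (v : 'M[R]_N) := \sum_i \sum_j v i j.
have sC : continuous s.
  apply: (continuous_big (@add_continuous R)) => i _.
  apply: (continuous_big (@add_continuous R)) => j _.
  exact: coord_continuous.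
have cs : s \o series (exp_term T u) @ \oo --> s (op_exp T u).
  by apply: cvg_comp (@cvg_op_exp T u) _; exact: sC.
rewrite -[LHS]/(s (op_exp T u)) -(cvg_lim (@norm_hausdorff _ _) cs).
apply: (cvg_lim (@norm_hausdorff _ _)); rewrite -cvg_shiftS.
rewrite (_ : [sequence _]_n = cst (s u)); first exact: cvg_cst.
have sD v w : s (v + w) = s v + s w.
  rewrite /s -big_split; apply: eq_bigr => i _ /=; rewrite -big_split.
  by apply: eq_bigr => j _; rewrite mxE.
apply/funext => m /=; elim: m => [|m IHm].
  by rewrite /series /= big_nat1 /exp_term invr1 scale1r.
rewrite seriesSr [s _]sD IHm -[RHS]addr0; congr (_ + _).
rewrite -[RHS](mulr0 (m.+1`!%:R^-1)) -(T0 (iter m T u)) /s mulr_sumr.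
apply: eq_bigr => i _; rewrite mulr_sumr; apply: eq_bigr => j _.
by rewrite mxE.
Qed.

Lemma op_exp_ge0 T (c : R) u :
  (forall v, (forall i j, 0 <= v i j) -> forall i j, 0 <= (T v + c *: v) i j) ->
  (forall i j, 0 <= u i j) -> forall i j, 0 <= op_exp T u i j.
Proof.
move=> Tc0 u0 i j.
have [M M0 TM] := matrix_linear_bounded T.
have cs : (fun m => series (exp_term (fun v => T v + c *: v) u) m i j) @ \oo -->
    (expR c *: op_exp T u) i j.
  have := cvg_comp _ _ (cvg_exp_term_shift T M M0 TM c u)
    (@coord_continuous _ _ _ i j _).
  exact.
rewrite mxE in cs; rewrite -(pmulr_rge0 _ (expR_gt0 c)).
apply: (cvgr_to_ge cs).
apply: nearW => m; rewrite /series /= summxE sumr_ge0// => k _.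
rewrite mxE mulr_ge0 ?invr_ge0 ?ler0n//.
by elim: k i j {cs} => //= k IHk i j; exact: Tc0.
Qed.

End MatrixExponential.

(** * The generator [tau L_h[phi]]: conservation, equilibrium, positivity *)

Section Grid.
Context {R : realType} {N : nat}.
Implicit Types (h tau : R) (u v phi p : 'M[R]_N).

Lemma sum_ordS (F : 'I_N -> R) : \sum_i F (ordS i) = \sum_i F i.
Proof. by rewrite [RHS](reindex_inj (@ordS_inj N)). Qed.

Lemma sum_ord_pred (F : 'I_N -> R) : \sum_i F (ord_pred i) = \sum_i F i.
Proof. by rewrite [RHS](reindex_inj (@ord_pred_inj N)). Qed.

Lemma Lop_is_linear h phi : linear (Lop h phi).
Proof.
move=> a u v; apply/matrixP => i j; rewrite !mxE /neighbours !big_cons.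
rewrite !big_nil /= !mxE; set A := expR _ + _; set B := expR _ + _.
set C := expR _ + _; set D := expR _ + _; ring.
Qed.

HB.instance Definition _ h phi :=
  GRing.isLinear.Build R 'M[R]_N 'M[R]_N *:%R (Lop h phi) (Lop_is_linear h phi).

(** Named in order to carry a linear structure; it unfolds to the lambda term in [etd1_solution]. *)
Definition etd_generator h tau phi u := tau *: Lop h phi u.

Lemma etd_generator_is_linear h tau phi : linear (etd_generator h tau phi).
Proof.
by move=> a u v; rewrite /etd_generator linearP scalerDr !scalerA mulrC.
Qed.

HB.instance Definition _ h tau phi :=
  GRing.isLinear.Build R 'M[R]_N 'M[R]_N *:%R (etd_generator h tau phi)
    (etd_generator_is_linear h tau phi).

(* Each edge of the torus carries two opposite fluxes. *)
Lemma sum_neighbours_antisymmetric (F : 'I_N * 'I_N -> 'I_N * 'I_N -> R) :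
  (forall a b, F a b = - F b a) ->
  \sum_i \sum_j \sum_(q <- neighbours i j) F q (i, j) = 0.
Proof.
move=> FN; pose G i j := F (ordS i, j) (i, j).
pose H i j := F (i, ordS j) (i, j).
have GE i j : F (ord_pred i, j) (i, j) = - G (ord_pred i) j.
  by rewrite FN /G ord_predK.
have HE i j : F (i, ord_pred j) (i, j) = - H i (ord_pred j).
  by rewrite FN /H ord_predK.
transitivity (\sum_i \sum_j (G i j - G (ord_pred i) j)
              + \sum_i \sum_j (H i j - H i (ord_pred j))).
  rewrite -big_split; apply: eq_bigr => i _; rewrite -big_split.
  apply: eq_bigr => j _; rewrite /neighbours !big_cons big_nil /= GE HE /G /H.
  ring.
rewrite [X in X + _]exchange_big /= !big1 ?addr0// => i _.
  by rewrite sumrB sum_ord_pred subrr.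
by rewrite sumrB (sum_ord_pred (fun k => G k i)) subrr.
Qed.

(** The flux [F] is antisymmetric: a harmonic mean, symmetric in the two ends of the edge, times a
    difference. *)
Lemma etd_generator_sum h tau phi u :
  \sum_i \sum_j etd_generator h tau phi u i j = 0.
Proof.
pose F (a b : 'I_N * 'I_N) := 2 * expR (phi a.1 a.2) * expR (phi b.1 b.2)
  / (expR (phi a.1 a.2) + expR (phi b.1 b.2))
  * (u a.1 a.2 / expR (phi a.1 a.2) - u b.1 b.2 / expR (phi b.1 b.2)).
transitivity (\sum_i \sum_j tau * ((h ^+ 2)^-1 *
    \sum_(q <- neighbours i j) F q (i, j))).
  by apply: eq_bigr => i _; apply: eq_bigr => j _; rewrite !mxE.
under eq_bigr do rewrite -mulr_sumr -mulr_sumr.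
rewrite -mulr_sumr -mulr_sumr sum_neighbours_antisymmetric ?mulr0// => a b.
by rewrite /F [expR (phi b.1 _) + _]addrC; ring.
Qed.

Lemma etd_generator_expR h tau phi :
  etd_generator h tau phi (map_mx expR phi) = 0.
Proof.
apply/matrixP => i j; rewrite !mxE big1 ?mulr0// => q _.
by rewrite !mxE !divff ?subrr ?mulr0// gt_eqF ?expR_gt0.
Qed.

(** An edge with end values [a], [b] of [e^phi] contributes [- 2 b / (a + b) >= - 2] to the
    diagonal. Four edges give the constant 8, whatever [phi] is. *)
Lemma etd_generator_shift_ge0 h tau phi u : 0 <= tau ->
  (forall i j, 0 <= u i j) -> forall i j,
  0 <= (etd_generator h tau phi u + (tau * ((h ^+ 2)^-1 * 8)) *: u) i j.
Proof.
move=> tau0 u0 i j; rewrite !mxE -mulrA -mulrDr mulr_ge0//.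
rewrite -mulrA -mulrDr mulr_ge0 ?invr_ge0 ?sqr_ge0//.
have -> : 8 * u i j = \sum_(q <- neighbours i j) 2 * u i j.
  by rewrite /neighbours !big_cons big_nil; ring.
rewrite -big_split sumr_ge0// => -[k l] _ /=.
have := expR_gt0 (phi k l); have := expR_gt0 (phi i j).
set a := expR (phi i j); set b := expR (phi k l) => a0 b0.
have -> : 2 * b * a / (b + a) * (u k l / b - u i j / a) + 2 * u i j =
    2 * a / (b + a) * (u k l + u i j).
  by field; rewrite !gt_eqF// addr_gt0.
by rewrite mulr_ge0 ?divr_ge0 ?mulr_ge0 ?addr_ge0// ltW.
Qed.

(* [x ln x] lies above its tangent at [a e^y]. *)
Lemma xlnx_tangent (x a y : R) : 0 <= x -> 0 < a ->
  (ln a + 1) * x - a * expR y <= x * ln x - x * y.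
Proof.
move=> x0 a0; have [->|xN0] := eqVneq x 0.
  by rewrite !mul0r !mulr0 !sub0r oppr0 oppr_le0 mulr_ge0 ?expR_ge0// ltW.
have {x0 xN0} x0 : 0 < x by rewrite lt_def xN0.
(* This is [ln t <= t - 1] at [t = a e^y / x], multiplied by [x]. *)
have : x * ln (a * expR y / x) <= x * (a * expR y / x - 1).
  rewrite ler_wpM2l ?(ltW x0)// -[X in ln X](addrNK 1) addrC le_ln1Dx//.
  by rewrite ltrBrDr addNr divr_gt0 ?mulr_gt0 ?expR_gt0.
rewrite ln_div ?posrE ?mulr_gt0 ?expR_gt0// lnM ?posrE ?expR_gt0// expRK.
have -> : x * (a * expR y / x - 1) = a * expR y - x by field; rewrite gt_eqF.
lra.
Qed.

(** * Decay of the relative entropy in one step *)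

Section Decay.
Variables (h tau : R) (phi : 'M[R]_N).
Hypothesis tau0 : 0 <= tau.
Let S := op_exp (etd_generator h tau phi).

Lemma etd_step_ge0 p : (forall i j, 0 <= p i j) -> forall i j, 0 <= S p i j.
Proof. by apply: op_exp_ge0 => v; apply: etd_generator_shift_ge0. Qed.

(* Jensen's inequality for the positive operator [S], which fixes [e^phi]. *)
Lemma entropy_jensen p : (forall i j, 0 <= p i j) -> forall i j,
  S p i j * ln (S p i j) - S p i j * phi i j <=
  S (\matrix_(i, j) (p i j * ln (p i j) - p i j * phi i j)) i j.
Proof.
move=> p0 i j; set g := \matrix_(i, j) _.
have Sp0 := etd_step_ge0 p p0 i j.
(* Use the tangent inequality with the same [a] at all grid points. The positive linear map [S]
   preserves it and fixes [e^phi]. *)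
have below a : 0 < a -> (ln a + 1) * S p i j - a * expR (phi i j) <= S g i j.
  move=> a0; rewrite -subr_ge0.
  have w0 k l : 0 <= (- (ln a + 1) *: p + (a *: map_mx expR phi + g)) k l.
    by rewrite !mxE; have := xlnx_tangent _ _ (phi k l) (p0 k l) a0; lra.
  have := etd_step_ge0 _ w0 i j.
  rewrite /S 2!op_exp_linear (op_exp_fixed _ _ (etd_generator_expR h tau phi)).
  by rewrite !mxE -/S; lra.
(* The optimal [a] is [S p i j / e^phi]; when it is 0, a small [a > 0] does. *)
have [Sp_eq0|SpN0] := eqVneq (S p i j) 0; last first.
  have {Sp0 SpN0} Sp0 : 0 < S p i j by rewrite lt_def SpN0.
  apply: le_trans (below (S p i j / expR (phi i j)) _).
    rewrite ln_div ?posrE ?expR_gt0// expRK divfK ?gt_eqF ?expR_gt0//; lra.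
  by rewrite divr_gt0 ?expR_gt0.
rewrite Sp_eq0 !mul0r subrr leNgt; apply/negP => g_lt0.
(* For this [a] the bound reads [S g i j / 2 <= S g i j], which is false for a negative value. *)
have := below (- S g i j / (2 * expR (phi i j))).
rewrite Sp_eq0 mulr0 sub0r.
have e0 := expR_gt0 (phi i j).
have -> : - (- S g i j / (2 * expR (phi i j)) * expR (phi i j)) = S g i j / 2.
  by field; rewrite gt_eqF.
rewrite divr_gt0 ?oppr_gt0 ?mulr_gt0// => /(_ isT); lra.
Qed.

(** Sum Jensen's inequality over the grid; [S] preserves the sum of the matrix on its right-hand
    side. *)
Lemma entropy_decay p : (forall i j, 0 <= p i j) ->
  \sum_i \sum_j (S p i j * ln (S p i j) - S p i j * phi i j) <=
  \sum_i \sum_j (p i j * ln (p i j) - p i j * phi i j).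
Proof.
move=> p0.
rewrite [leRHS](_ : _ = \sum_i \sum_j
    (\matrix_(i, j) (p i j * ln (p i j) - p i j * phi i j)) i j); last first.
  by apply: eq_bigr => i _; apply: eq_bigr => j _; rewrite mxE.
rewrite -(op_exp_sum (etd_generator h tau phi)); last first.
  exact: etd_generator_sum.
by apply: ler_sum => i _; apply: ler_sum => j _; exact: entropy_jensen.
Qed.

End Decay.

End Grid.

(** * Summation by parts and the discrete Poisson equation *)

Section Poisson.
Context {R : realType} {N : nat}.
Implicit Types (h eps tau : R) (u v w f phi p : 'M[R]_N).

Lemma inner_grid1 h u : inner h u grid1 = h ^+ 2 * \sum_i \sum_j u i j.
Proof.
congr (_ * _); apply: eq_bigr => i _; apply: eq_bigr => j _.
by rewrite mxE mulr1.
Qed.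

Lemma laplacian_is_linear h : linear (@laplacian R N h).
Proof. by move=> a u v; apply/matrixP => i j; rewrite !mxE; ring. Qed.

HB.instance Definition _ h :=
  GRing.isLinear.Build R 'M[R]_N 'M[R]_N *:%R (@laplacian R N h)
    (laplacian_is_linear h).

Lemma inner_laplacian h u v : h != 0 ->
  inner h (laplacian h u) v = - grad_inner h u v.
Proof.
move=> h0; apply/eqP; rewrite -addr_eq0 -mulrDr mulf_eq0; apply/orP; right.
(* At each grid point the two summands add up to cyclic differences of the edge terms [f] and [g],
   which telescope. *)
pose f i j := (u i j - u (ord_pred i) j) / h ^+ 2 * v (ord_pred i) j.
pose g i j := (u i j - u i (ord_pred j)) / h ^+ 2 * v i (ord_pred j).
apply/eqP; transitivity (\sum_i \sum_j (f (ordS i) j - f i j)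
                         + \sum_i \sum_j (g i (ordS j) - g i j)).
  rewrite -!big_split; apply: eq_bigr => i _; rewrite -!big_split.
  by apply: eq_bigr => j _; rewrite !mxE /f /g /= !ordSK; field.
rewrite [X in X + _]exchange_big /= !big1 ?addr0// => i _.
  by rewrite sumrB sum_ordS subrr.
by rewrite sumrB (sum_ordS (f^~ i)) subrr.
Qed.

Lemma grad_inner_ge0 h u : 0 <= grad_inner h u u.
Proof.
rewrite mulr_ge0 ?sqr_ge0// sumr_ge0// => i _; rewrite sumr_ge0// => j _.
by rewrite addr_ge0// -expr2 sqr_ge0.
Qed.

Lemma sqr_grad_norm h u : grad_norm h u ^+ 2 = grad_inner h u u.
Proof. by rewrite sqr_sqrtr ?grad_inner_ge0. Qed.

Lemma grad_innerD h u v :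
  grad_inner h (u + v) (u + v) =
  grad_inner h u u + 2 * grad_inner h v u + grad_inner h v v.
Proof.
rewrite /grad_inner mulrCA -!mulrDr; congr (_ * _).
rewrite mulr_sumr -!big_split; apply: eq_bigr => i _ /=.
rewrite mulr_sumr -!big_split; apply: eq_bigr => j _ /=.
by rewrite !mxE; ring.
Qed.

Lemma ord_pred_invariant (F : 'I_N -> R) : (forall i, F (ord_pred i) = F i) ->
  forall i j, F i = F j.
Proof.
move=> FS.
(* [N] is not syntactically a successor, so the index 0 enters as any [i] of value 0. *)
suff F0 (i j : 'I_N) : i = 0%N :> nat -> F j = F i.
  move=> i j; pose o := Ordinal (leq_ltn_trans (leq0n i) (ltn_ord i)).
  by rewrite (F0 o i)// (F0 o j).
move=> i0; case: j => j; elim: j => [|j IHj] jN.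
  by congr F; apply: val_inj; rewrite /= i0.
rewrite -(IHj (ltnW jN)) -FS; congr F; apply: val_inj => /=.
by rewrite modnDr modn_small// ltnW.
Qed.

Lemma grad_inner_eq0 h u : h != 0 -> grad_inner h u u = 0 ->
  forall i j k l, u i j = u k l.
Proof.
move=> h0 /eqP; rewrite mulf_eq0 expf_eq0 (negbTE h0) andbF /=.
pose e i j := (u i j - u (ord_pred i) j) / h * ((u i j - u (ord_pred i) j) / h)
  + (u i j - u i (ord_pred j)) / h * ((u i j - u i (ord_pred j)) / h).
have e0 i j : 0 <= e i j by rewrite addr_ge0// -expr2 sqr_ge0.
rewrite psumr_eq0 => [/allP e_eq0|i _];
  last by apply: sumr_ge0 => j _; exact: e0.
have {e_eq0} eq i j : (u (ord_pred i) j = u i j) * (u i (ord_pred j) = u i j).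
  have := e_eq0 i (mem_index_enum i).
  rewrite psumr_eq0 => [|k _]; last exact: e0.
  move=> /allP/(_ j (mem_index_enum j)) /=.
  rewrite -!expr2 paddr_eq0 ?sqr_ge0// !sqrf_eq0 !mulf_eq0 invr_eq0 (negbTE h0).
  by rewrite !orbF !subr_eq0 => /andP[/eqP <- /eqP <-].
move=> i j k l; transitivity (u k j).
  by apply: (ord_pred_invariant (u^~ j)) => i'; rewrite eq.
by apply: (ord_pred_invariant (u k)) => j'; rewrite eq.
Qed.

Definition grid_sum u : R := \sum_i \sum_j u i j.

Lemma grid_sum_is_linear : linear (grid_sum : 'M[R]_N -> R^o).
Proof.
move=> a u v; rewrite /grid_sum scaler_sumr -big_split.
apply: eq_bigr => i _ /=; rewrite scaler_sumr -big_split.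
by apply: eq_bigr => j _; rewrite !mxE.
Qed.

HB.instance Definition _ :=
  GRing.isLinear.Build R 'M[R]_N R^o *:%R grid_sum grid_sum_is_linear.

Lemma grid_sum_const c : grid_sum (const_mx c) = c * (N%:R * N%:R).
Proof.
rewrite /grid_sum; under eq_bigr do under eq_bigr do rewrite mxE.
by rewrite !sumr_const !card_ord -mulrnA -natrM mulr_natr.
Qed.

(** Summation by parts against the constant 1, whose gradient vanishes. *)
Lemma grid_sum_laplacian h u : h != 0 -> grid_sum (laplacian h u) = 0.
Proof.
move=> h0; have h20 : h ^+ 2 != 0 by rewrite expf_neq0.
apply: (mulfI h20); rewrite mulr0 -inner_grid1 inner_laplacian//.
rewrite /grad_inner !big1 ?mulr0 ?oppr0// => i _.
by rewrite big1// => j _; rewrite !mxE !subrr !mul0r !mulr0 addr0.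
Qed.

(** Summation by parts against [u] itself kills the gradient, so [u] is constant, and its zero sum
    makes the constant 0. *)
Lemma laplacian_eq0 h u : h != 0 ->
  grid_sum u = 0 -> laplacian h u = 0 -> u = 0.
Proof.
move=> h0 su lapu; have /(grad_inner_eq0 h u h0) cu : grad_inner h u u = 0.
  by apply: oppr_inj; rewrite -inner_laplacian// lapu oppr0 /inner big1 ?mulr0//
    => i _; rewrite big1// => j _; rewrite mxE mul0r.
apply/matrixP => i j; rewrite mxE.
have uE : u = const_mx (u i j).
  by apply/matrixP => k l; rewrite mxE (cu k l i j).
move: su; rewrite uE grid_sum_const mxE => /eqP; rewrite mulf_eq0.
move=> /orP[/eqP//|].
(* The existence of the index [i] excludes [N = 0]. *)
by rewrite mulf_eq0 pnatr_eq0 orbb => /eqP N0; move: (ltn_ord i); rewrite {2}N0.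
Qed.

(* Adding the mean makes the Laplacian injective, hence surjective since the
   space is finite-dimensional. *)
Lemma poisson_invP h eps f : (0 < N)%N -> h != 0 -> eps != 0 ->
  inner h f grid1 = 0 ->
  (- eps ^+ 2) *: laplacian h (poisson_inv h eps f) = f.
Proof.
move=> N0 h0 eps0 f0.
have h20 : h ^+ 2 != 0 by rewrite expf_neq0.
have e20 : - eps ^+ 2 != 0 by rewrite oppr_eq0 expf_neq0.
have NN0 : (N%:R * N%:R : R) != 0 by rewrite mulf_neq0// pnatr_eq0 -lt0n.
have {}f0 : grid_sum f = 0 by apply: (mulfI h20); rewrite mulr0 -inner_grid1.
(* Once a solution exists, [xget] returns one rather than the default 0. *)
suff /(xgetPex 0)[] : [set phi | (- eps ^+ 2) *: laplacian h phi = f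
                                /\ inner h phi grid1 = 0] !=set0 by [].
pose G u : 'M[R]_N := (- eps ^+ 2) *: laplacian h u + const_mx (grid_sum u).
have G_linear : linear G.
  move=> a u v.
  have sP : grid_sum (a *: u + v) = a * grid_sum u + grid_sum v.
    by rewrite grid_sum_is_linear.
  by rewrite /G sP linearP /=; apply/matrixP => i j; rewrite !mxE; ring.
pose GL := GRing.isLinear.Build R 'M[R]_N 'M[R]_N *:%R G G_linear.
pose Gl : {linear 'M[R]_N -> 'M[R]_N} := HB.pack G GL.
(* The Laplacian part has zero sum, so the sum of [G u] determines that of [u]. This reduces
   injectivity to [laplacian_eq0] and makes the added constant vanish at the preimage of [f]. *)
have sG u : grid_sum (G u) = grid_sum u * (N%:R * N%:R).
  rewrite /G linearD linearZ /= grid_sum_const grid_sum_laplacian//.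
  by rewrite scaler0 add0r.
have G0 u : G u = 0 -> u = 0.
  move=> Gu; have su : grid_sum u = 0.
    by apply: (mulIf NN0); rewrite mul0r -sG Gu linear0.
  apply: (laplacian_eq0 h) => //; apply: (scalerI e20).
  by rewrite scaler0 -Gu /G su [X in _ = _ + X](_ : _ = 0) ?addr0//;
    apply/matrixP => i j; rewrite !mxE.
have kerG : lker (linfun Gl) == 0%VS.
  rewrite -subv0; apply/subvP => u; rewrite memv_ker memv0 lfunE /= => /eqP.
  by move=> /G0 ->.
pose phi := ((linfun Gl)^-1)%VF f.
have Gphi : G phi = f by have := lker0_lfunVK kerG f; rewrite lfunE.
have sphi : grid_sum phi = 0.
  by apply: (mulIf NN0); rewrite mul0r -sG Gphi f0.
exists phi; split; last by rewrite inner_grid1 [X in _ * X]sphi mulr0.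
by rewrite -[RHS]Gphi /G sphi [X in _ = _ + X](_ : _ = 0) ?addr0//;
  apply/matrixP => i j; rewrite !mxE.
Qed.

Lemma innerBl h u v w : inner h (u - v) w = inner h u w - inner h v w.
Proof.
rewrite -mulrBr; congr (_ * _); rewrite -sumrB; apply: eq_bigr => i _.
by rewrite -sumrB; apply: eq_bigr => j _; rewrite !mxE mulrBl.
Qed.

Lemma innerZl h a u v : inner h (a *: u) v = a * inner h u v.
Proof.
rewrite mulrCA; congr (_ * _); rewrite mulr_sumr; apply: eq_bigr => i _.
by rewrite mulr_sumr; apply: eq_bigr => j _; rewrite mxE mulrA.
Qed.

Lemma innerNr h u v : inner h u (- v) = - inner h u v.
Proof.
rewrite -mulrN; congr (_ * _); rewrite -sumrN; apply: eq_bigr => i _.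
by rewrite -sumrN; apply: eq_bigr => j _; rewrite mxE mulrN.
Qed.

Lemma relative_entropyE h p phi :
  h ^+ 2 * \sum_i \sum_j (p i j * ln (p i j) - p i j * phi i j) =
  inner h (xlnx p) grid1 - inner h p phi.
Proof.
rewrite inner_grid1 -mulrBr; congr (_ * _); rewrite -sumrB.
apply: eq_bigr => i _; rewrite -sumrB; apply: eq_bigr => j _.
by rewrite mxE.
Qed.

Lemma relative_entropy_step h tau phi p : 0 <= tau ->
  (forall i j, 0 <= p i j) ->
  inner h (xlnx (op_exp (etd_generator h tau phi) p)) grid1
    - inner h (op_exp (etd_generator h tau phi) p) phi <=
  inner h (xlnx p) grid1 - inner h p phi.
Proof.
move=> tau0 p0; rewrite -!relative_entropyE ler_wpM2l ?sqr_ge0//.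
exact: entropy_decay.
Qed.

End Poisson.

(** * The energy estimate *)

Theorem theorem5 (R : realType) (L : R) (N : nat) (hL : 0 < L) (hN : (0 < N)%N)
    (eps tau : R) (heps : 0 < eps) (htau : 0 < tau)
    (p0 n0 rhof : 'M[R]_N) (p n phi : nat -> 'M[R]_N) :
  let h := L / N%:R in
  inner h (p0 - n0 + rhof) grid1 = 0 ->
  etd1_solution h eps tau rhof p0 n0 p n phi ->
  (forall i j, 0 <= p0 i j) ->
  (forall i j, 0 <= n0 i j) ->
  forall k : nat,
    energy h eps (p k.+1) (n k.+1) (phi k.+1)
    <= energy h eps (p k) (n k) (phi k)
       + eps ^+ 2 / 2 * grad_norm h (phi k.+1 - phi k) ^+ 2.
Proof.
move=> h mean0 [p0E n0E phiE pS nS] p0_ge0 n0_ge0 k.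
have h0 : h != 0 by rewrite mulf_neq0 ?invr_eq0 ?pnatr_eq0 -?lt0n ?gt_eqF.
have {}pS m : p m.+1 = op_exp (etd_generator h tau (- phi m)) (p m) := pS m.
have {}nS m : n m.+1 = op_exp (etd_generator h tau (phi m)) (n m) := nS m.
have tau0 := ltW htau.
have p_ge0 m i j : 0 <= p m i j.
  elim: m i j => [|m IHm]; first by rewrite p0E.
  by rewrite pS; exact: etd_step_ge0.
have n_ge0 m i j : 0 <= n m i j.
  elim: m i j => [|m IHm]; first by rewrite n0E.
  by rewrite nS; exact: etd_step_ge0.
(* Both exponentials conserve the grid sum, so every Poisson problem of the scheme is solvable. *)
have mean m : inner h (p m - n m + rhof) grid1 = 0.
  elim: m => [|m IHm]; first by rewrite p0E n0E.
  rewrite -IHm !inner_grid1; congr (_ * _).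
  rewrite -[LHS]/(grid_sum _) -[RHS]/(grid_sum _) !(raddfD, raddfN) /=.
  have gS (psi u : 'M[R]_N) :
      grid_sum (op_exp (etd_generator h tau psi) u) = grid_sum u.
    by apply: op_exp_sum; exact: etd_generator_sum.
  by rewrite pS nS (gS (- phi m) (p m)) (gS (phi m) (n m)).
have poisson m : (- eps ^+ 2) *: laplacian h (phi m) = p m - n m + rhof.
  by rewrite phiE poisson_invP// gt_eqF.
have pstep := relative_entropy_step h tau (- phi k) (p k) tau0 (p_ge0 k).
have nstep := relative_entropy_step h tau (phi k) (n k) tau0 (n_ge0 k).
rewrite -pS !innerNr in pstep; rewrite -nS in nstep.
set D := phi k.+1 - phi k.
(* Subtracting the Poisson equations at [k + 1] and [k] cancels [rhof]; then sum by parts against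
   [phi k]. *)
have cross : eps ^+ 2 * grad_inner h D (phi k) =
    inner h (p k.+1) (phi k) - inner h (n k.+1) (phi k)
    - (inner h (p k) (phi k) - inner h (n k) (phi k)).
  rewrite -!innerBl -[LHS]mulrNN -inner_laplacian// -innerZl; congr inner.
  by rewrite /D linearB scalerBr !poisson opprD addrACA subrr addr0.
have := grad_innerD h (phi k) D; rewrite [phi k + D]addrC subrK => gradS.
rewrite /energy !sqr_grad_norm gradS.
lra.
Qed.
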